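(* Let $M$ be an $H_v$-module over an $H_v$-ring $R$. If $A=(\mu_A,\lambda_A)$ is an intuitionistic fuzzy $H_v$-submodule of $M$, then for every $t\in \mathrm{Im}(\mu_A)\cap \mathrm{Im}(\lambda_A)$ the sets $U(\mu_A;t)=\{x\in M\mid\mu_A(x)\ge t\}$ and $L(\lambda_A;t)=\{x\in M\mid\lambda_A(x)\le t\}$ are $H_v$-submodules of $M$.
   Context: Hyperoperations. For a non-empty set $H$, $\mathcal P^*(H)$ is the set of non-empty subsets of $H$; a hyperoperation on $H$ is a map $*:H\times H\to\mathcal P^*(H)$. For subsets $A,B\subseteq H$ put $A*B=\bigcup_{a\in A,b\in B}a*b$, and $x*B=\{x\}*B$, $A*x=A*\{x\}$ (likewise for external hyperoperations $R\times M\to\mathcal P^*(M)$). $(H,* )$ is an $H_v$-semigroup if $(x*(y*z))\cap((x*y)*z)\neq\emptyset$ for all $x,y,z\in H$; it is an $H_v$-group if moreover $a*H=H*a=H$ for all $a\in H$. It is weak commutative if $(x*y)\cap(y*x)\ne\emptyset$ for all $x,y$. An $H_v$-ring is a set $R$ with hyperoperations $+,\cdot$ such that $(R,+)$ is an $H_v$-group, $(R,\cdot)$ is an $H_v$-semigroup, and $(x\cdot(y+z))\cap(x\cdot y+x\cdot z)\neq\emptyset$, $((x+y)\cdot z)\cap(x\cdot z+y\cdot z)\ne\emptyset$ for all $x,y,z\in R$. An $H_v$-module over an $H_v$-ring $R$ is a non-empty set $M$ with a hyperoperation $+$ making $(M,+)$ a weak commutative $H_v$-group and a map $\cdot:R\times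 M\to\mathcal P^*(M)$ such that for all $a,b\in R$, $x,y\in M$: $(a\cdot(x+y))\cap(a\cdot x+a\cdot y)\ne\emptyset$, $((a+b)\cdot x)\cap(a\cdot x+b\cdot x)\neq\emptyset$, $((ab)\cdot x)\cap(a\cdot(b\cdot x))\ne\emptyset$. A non-empty subset $S\subseteq M$ is an $H_v$-submodule of $M$ if $(S,+)$ is an $H_v$-subgroup of $(M,+)$, i.e. $a+S=S+a=S$ for all $a\in S$, and $R\cdot S\subseteq S$. Fuzzy sets. A fuzzy set in $X$ is a map $\mu:X\to[0,1]$. An intuitionistic fuzzy set in $X$ is a pair $A=(\mu_A,\lambda_A)$ of fuzzy sets in $X$ with $0\le\mu_A(x)+\lambda_A(x)\le1$ for all $x\in X$. An intuitionistic fuzzy set $A=(\mu_A,\lambda_A)$ in $M$ is an intuitionistic fuzzy $H_v$-submodule of $M$ if: (1) $\min\{\mu_A(x),\mu_A(y)\}\le\inf\{\mu_A(z)\mid z\in x+y\}$ for all $x,y\in M$; (2) for all $x,a\in M$ there exist $y,z\in M$ with $x\in(a+y)\cap(z+a)$ and $\min\{\mu_A(a),\mu_A(x)\}\le\min\{\mu_A(y),\mu_A(z)\}$; (3) $\mu_A(x)\le\inf\{\mu_A(z)\mid z\in r\cdot x\}$ for all $x\in M$, $r\in R$; (4) $\sup\{\lambda_A(z)\mid z\in x+y\}\le\max\{\lambda_A(x),\lambda_A(y)\}$ for all $x,y\in M$; (5) for all $x,a\in M$ there exist $y,z\in M$ with $x\in(a+y)\cap(z+a)$ and $\max\{\lambda_A(y),\lambda_A(z)\}\le\max\{\lambda_A(a),\lambda_A(x)\}$;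 (6) $\sup\{\lambda_A(z)\mid z\in r\cdot x\}\le\lambda_A(x)$ for all $x\in M$, $r\in R$. *)

(* Defs.v *)
From mathcomp Require Import all_boot all_order all_algebra.
From mathcomp Require Import boolp classical_sets reals.
Import Order.TTheory GRing.Theory Num.Theory.

Set Implicit Arguments.
Unset Strict Implicit.
Unset Printing Implicit Defensive.

Local Open Scope classical_set_scope.
Local Open Scope ring_scope.

(* A map A x B -> P^*(C); [hyperop H H H] is a hyperoperation on H, and
   [hyperop R M M] an external one. *)
Record hyperop (A B C : Type) := Hyperop {
  hop :> A -> B -> set C;
  hop_nonempty : forall a b, hop a b !=set0 }.

Definition hop_set (A B C : Type) (op : hyperop A B C) (X : set A) (Y : set B)
  : set C := \bigcup_(a in X) \bigcup_(b in Y) op a b.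

Section OneHyperoperation.
Variables (H : Type) (op : hyperop H H H).

(* Carriers of hyperoperations are non-empty; as [H] is an arbitrary type this
   has to be required. *)
Record is_Hv_semigroup : Prop := IsHvSemigroup {
  Hv_nonempty : [set: H] !=set0;
  Hv_weak_assoc : forall x y z,
    hop_set op [set x] (op y z) `&` hop_set op (op x y) [set z] !=set0 }.

Record is_Hv_group : Prop := IsHvGroup {
  Hv_group_semigroup : is_Hv_semigroup;
  Hv_reproductionl : forall a, hop_set op [set a] setT = setT;
  Hv_reproductionr : forall a, hop_set op setT [set a] = setT }.

Definition weak_commutative : Prop :=
  forall x y, op x y `&` op y x !=set0.

Definition is_Hv_subgroup (S : set H) : Prop :=
  S !=set0 /\
  forall a, S a -> hop_set op [set a] S = S /\ hop_set op S [set a] = S.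

End OneHyperoperation.

Record Hv_ring := HvRing {
  Hv_ring_sort :> Type;
  radd : hyperop Hv_ring_sort Hv_ring_sort Hv_ring_sort;
  rmul : hyperop Hv_ring_sort Hv_ring_sort Hv_ring_sort;
  radd_Hv_group : is_Hv_group radd;
  rmul_Hv_semigroup : is_Hv_semigroup rmul;
  rmul_weak_distrl : forall x y z,
    hop_set rmul [set x] (radd y z)
      `&` hop_set radd (rmul x y) (rmul x z) !=set0;
  rmul_weak_distrr : forall x y z,
    hop_set rmul (radd x y) [set z]
      `&` hop_set radd (rmul x z) (rmul y z) !=set0 }.

Arguments radd {R} : rename.
Arguments rmul {R} : rename.

Record Hv_module (R : Hv_ring) := HvModule {
  Hv_module_sort :> Type;
  madd : hyperop Hv_module_sort Hv_module_sort Hv_module_sort;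
  mscale : hyperop R Hv_module_sort Hv_module_sort;
  madd_Hv_group : is_Hv_group madd;
  madd_weak_commutative : weak_commutative madd;
  mscale_weak_distrl : forall (a : R) (x y : Hv_module_sort),
    hop_set mscale [set a] (madd x y)
      `&` hop_set madd (mscale a x) (mscale a y) !=set0;
  mscale_weak_distrr : forall (a b : R) (x : Hv_module_sort),
    hop_set mscale (radd a b) [set x]
      `&` hop_set madd (mscale a x) (mscale b x) !=set0;
  mscale_weak_assoc : forall (a b : R) (x : Hv_module_sort),
    hop_set mscale (rmul a b) [set x]
      `&` hop_set mscale [set a] (mscale b x) !=set0 }.

Arguments madd {R M} : rename.
Arguments mscale {R M} : rename.

Definition is_Hv_submodule (R : Hv_ring) (M : Hv_module R) (S : set M) : Prop :=
  is_Hv_subgroup madd S /\ hop_set mscale [set: R] S `<=` S.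

Record fuzzy_set (K : realType) (X : Type) := FuzzySet {
  fuzzy_fun :> X -> K;
  fuzzy_in01 : forall x, 0 <= fuzzy_fun x <= 1 }.

Record int_fuzzy_set (K : realType) (X : Type) := IntFuzzySet {
  membership : fuzzy_set K X;
  nonmembership : fuzzy_set K X;
  membershipD_in01 : forall x, 0 <= membership x + nonmembership x <= 1 }.

(* Every [inf] and [sup] below is over a non-empty subset of [0, 1], so the
   default values of these total operators play no role. *)
Record is_int_fuzzy_Hv_submodule (K : realType) (R : Hv_ring) (M : Hv_module R)
    (A : int_fuzzy_set K M) : Prop := IsIntFuzzyHvSubmodule {
  membership_add : forall x y : M,
    Num.min (membership A x) (membership A y)
      <= inf [set membership A z | z in madd x y];
  membership_solve : forall x a : M, exists y z : M,
    (madd a y `&` madd z a) x /\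
    Num.min (membership A a) (membership A x)
      <= Num.min (membership A y) (membership A z);
  membership_scale : forall (x : M) (r : R),
    membership A x <= inf [set membership A z | z in mscale r x];
  nonmembership_add : forall x y : M,
    sup [set nonmembership A z | z in madd x y]
      <= Num.max (nonmembership A x) (nonmembership A y);
  nonmembership_solve : forall x a : M, exists y z : M,
    (madd a y `&` madd z a) x /\
    Num.max (nonmembership A y) (nonmembership A z)
      <= Num.max (nonmembership A a) (nonmembership A x);
  nonmembership_scale : forall (x : M) (r : R),
    sup [set nonmembership A z | z in mscale r x] <= nonmembership A x }.

Definition upper_level (K : realType) (X : Type) (mu : fuzzy_set K X) (t : K)
  : set X := [set x | t <= mu x].

Definition lower_level (K : realType) (X : Type) (lambda : fuzzy_set K X)
  (t : K) : set X := [set x | lambda x <= t].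

(* Main.v *)
Require Import Defs.
From mathcomp Require Import all_boot all_order all_algebra.
From mathcomp Require Import boolp classical_sets reals.
Import Order.TTheory GRing.Theory Num.Theory.

Local Open Scope classical_set_scope.
Local Open Scope ring_scope.

(** Comparing values with a fixed threshold [t] turns each fuzzy axiom into a crisp one: the [inf]
    and [sup] conditions say that a level set is closed under [madd] and [mscale], and the
    solvability conditions say that [x] in [a + y] and in [z + a] can be solved inside the level
    set. For such a set, closure gives [a + S] and [S + a] inside [S], and solvability gives the
    reverse inclusions. *)

Lemma Hv_submodule_of_closed (R : Hv_ring) (M : Hv_module R) (S : set M) :
  S !=set0 ->
  (forall x y, S x -> S y -> madd x y `<=` S) ->
  (forall x a, S x -> S a ->
     exists y z, [/\ S y, S z & (madd a y `&` madd z a) x]) ->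
  (forall (r : R) x, S x -> mscale r x `<=` S) ->
  is_Hv_submodule S.
Proof.
move=> S0 addS solveS scaleS; split; last first.
  by move=> w [r _ [x Sx wrx]]; exact: scaleS wrx.
split=> // a Sa; split; apply/seteqP; split=> x.
- by move=> [_ -> [y Sy xay]]; exact: addS xay.
- move=> Sx; have [y [z [Sy _ [xay _]]]] := solveS x a Sx Sa.
  by exists a => //; exists y.
- by move=> [y Sy [_ -> xya]]; exact: addS xya.
- move=> Sx; have [y [z [_ Sz [_ xza]]]] := solveS x a Sx Sa.
  by exists z => //; exists a.
Qed.

Section FuzzyBounds.
Variables (K : realType) (X : Type) (f : fuzzy_set K X) (B : set X).

(** The total [inf] is a true lower bound only for a set bounded below; here 0 bounds all values,
    and dually 1 serves for [sup]. *)
Lemma fuzzy_inf_le (z : X) : B z -> inf [set f x | x in B] <= f z.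
Proof.
move=> Bz; apply: ge_inf; last by exists z.
by exists 0 => _ [x _ <-]; have /andP[] := fuzzy_in01 f x.
Qed.

Lemma fuzzy_le_sup (z : X) : B z -> f z <= sup [set f x | x in B].
Proof.
move=> Bz; apply: ub_le_sup; last by exists z.
by exists 1 => _ [x _ <-]; have /andP[] := fuzzy_in01 f x.
Qed.

End FuzzyBounds.

Theorem theorem4p7 (K : realType) (R : Hv_ring) (M : Hv_module R)
  (A : int_fuzzy_set K M) (hA : is_int_fuzzy_Hv_submodule A)
  (t : K) (ht : (range (membership A) `&` range (nonmembership A)) t) :
  is_Hv_submodule (upper_level (membership A) t) /\
  is_Hv_submodule (lower_level (nonmembership A) t).
Proof.
(* Since [t] is attained by both functions, at [u] and at [l], neither level set is empty. *)
case: ht => -[u _ ut] [l _ lt]; split; apply: Hv_submodule_of_closed.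
- by exists u; rewrite /upper_level /= ut.
- move=> x y tx ty z zxy; apply: le_trans (fuzzy_inf_le _ _ _ _ _ zxy).
  by apply: le_trans (membership_add hA x y); rewrite le_min; apply/andP.
- move=> x a tx ta; have [y [z [xyz le_yz]]] := membership_solve hA x a.
  (* A minimum is at least [t] exactly when both entries are, so this one bound puts both [y] and
     [z] in the level set. *)
  have : t <= Num.min (membership A y) (membership A z).
    by apply: le_trans le_yz; rewrite le_min; apply/andP.
  by rewrite le_min => /andP[ty tz]; exists y, z.
- move=> r x tx z zrx; apply: le_trans (fuzzy_inf_le _ _ _ _ _ zrx).
  exact: le_trans tx (membership_scale hA x r).
(* The lower level set is the order dual: [max] and [sup] replace [min] and [inf]. *)
- by exists l; rewrite /lower_level /= lt.
- move=> x y xt yt z zxy; apply: le_trans (fuzzy_le_sup _ _ _ _ _ zxy) _.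
  by apply: le_trans (nonmembership_add hA x y) _; rewrite ge_max; apply/andP.
- move=> x a xt at_; have [y [z [xyz le_yz]]] := nonmembership_solve hA x a.
  have : Num.max (nonmembership A y) (nonmembership A z) <= t.
    by apply: le_trans le_yz _; rewrite ge_max; apply/andP.
  by rewrite ge_max => /andP[yt zt]; exists y, z.
- move=> r x xt z zrx; apply: le_trans (fuzzy_le_sup _ _ _ _ _ zrx) _.
  exact: le_trans (nonmembership_scale hA x r) xt.
Qed.
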